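(* Let $m$ and $n$ be positive integers, and suppose that $m = 2^k$ for some nonnegative integer $k$. Then the exponent of $2$ in the prime factorisation of $B(m, n)$ equals $s_2(n)$.
   Context: For positive integers $m$ and $n$, $B(m, n)$ denotes the number of balanced colourings of a $2m \times 2n$ rectangular grid, i.e., the number of ways to colour each cell black or white so that, in each row and each column, half of the cells are white and half are black. (An $a \times b$ grid has width $a$ and height $b$: each row consists of $a$ cells and each column of $b$ cells.) For a positive integer $x$, $s_2(x)$ denotes the number of $1$s in the binary expansion of $x$. *)

(* Defs.v *)
From mathcomp Require Import all_boot all_algebra.

Set Implicit Arguments.
Unset Strict Implicit.
Unset Printing Implicit Defensive.

(* A colouring of the grid of width a and height b is a matrix with b rows and
   a columns; true stands for black and false for white. *)
Definition colouring (a b : nat) := 'M[bool]_(b, a).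

(* In a grid of width 2m and height 2n, a row has 2m cells and a column has 2n
   cells, so half of a row is m cells and half of a column is n cells. *)
Definition balanced (m n : nat) (C : colouring (2 * m) (2 * n)) : bool :=
  [forall i, (#|[set j | C i j]| == m) && (#|[set j | ~~ C i j]| == m)] &&
  [forall j, (#|[set i | C i j]| == n) && (#|[set i | ~~ C i j]| == n)].

Definition B (m n : nat) : nat :=
  #|[set C : colouring (2 * m) (2 * n) | balanced C]|.

Definition binary_digit (x i : nat) : nat := (x %/ 2 ^ i) %% 2.

(* Since x < 2 ^ x, every nonzero binary digit of x has index less than x. *)
Definition s2 (x : nat) : nat :=
  #|[set i : 'I_x | binary_digit x i == 1]|.

(* Main.v *)
Require Import Defs.
From mathcomp Require Import all_boot.
From mathcomp Require Import matrix zify.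

(** Read a colouring as the family of its columns, each column being the set of
    its black rows: an n-element subset of the 2n rows, such that every row lies
    in exactly m of the 2m columns. Let S be the first column. There are
    'C(2n, n) choices of S, and permuting the rows shows that each of them has
    the same number A of completions, so B(m, n) = 'C(2n, n) * A. By Legendre's
    formula the exponent of 2 in 'C(2n, n) is s_2(n); this is
    [logn_central_binomial]. It remains to see that A is odd, which is where
    m = 2^k enters.

    A completion has 2^(k+1) - 1 columns, and row i has to lie in m - [i in S]
    of them. Consider more generally 2K + 1 columns with prescribed row sums r:
    one single column and two batches of K columns. Swapping the batches is an
    involution, so modulo 2 only the families whose two batches coincide count.
    In such a family the single column must be the set of rows with odd r, and
    one batch is a family of K columns with row sums r / 2. Hence, if exactly n
    of the r(i) are odd, the parity for (2K + 1, r) is the parity for (K, r / 2);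
    this is [odd_card_fillings_double].

    The row sums 2^k - [i in S] reproduce themselves: for k > 0 the odd ones are
    those with i in S, and halving gives 2^(k-1) - [i in S]. At k = 0 the odd
    ones are those with i outside S, again n in number, and halving leaves zero
    columns with row sums 0, which can be filled in exactly one way. So A is
    odd; this is [odd_card_fillings]. *)

Set Implicit Arguments.
Unset Strict Implicit.
Unset Printing Implicit Defensive.

(** * Families of columns with prescribed row sums *)

Lemma odd_card_involution (T : finType) (h : T -> T) (A : {set T}) :
    involutive h -> (forall x, (h x \in A) = (x \in A)) ->
  odd #|A| = odd #|[set x in A | h x == x]|.
Proof.
move=> hK hA; rewrite -(cardsID [set x | h x == x] A).
rewrite (_ : A :&: _ = [set x in A | h x == x]); last first.
  by apply/setP=> x; rewrite !inE.
rewrite oddD; set M := A :\: _.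
suff -> : odd #|M| = false by rewrite addbF.
(* An arbitrary total order on T picks one element from each 2-element orbit. *)
pose up x := enum_rank x < enum_rank (h x).
rewrite -(cardsID [set x | up x] M).
have -> : #|M :\: [set x | up x]| = #|M :&: [set x | up x]|.
  rewrite -(card_imset _ (inv_inj hK)); apply: eq_card => x; apply/imsetP/idP.
  - case=> y; rewrite !inE /up => /and3P[yup hy yA] ->.
    rewrite hA hK yA eq_sym hy /= ltn_neqAle leqNgt yup andbT.
    by rewrite (inj_eq val_inj) (inj_eq enum_rank_inj).
  rewrite !inE /up => /andP[/andP[hx xA] xup].
  by exists (h x); rewrite ?hK // !inE /up hK hA xA eq_sym hx -leqNgt ltnW.
by rewrite addnn odd_double.
Qed.

Lemma big_option (T : finType) (F : option T -> nat) :
  \sum_x F x = F None + \sum_x F (Some x).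
Proof.
rewrite (bigD1 None) //=; congr (_ + _).
rewrite (reindex_omap Some id) //=; last by case.
by apply: eq_bigl => x; rewrite eqxx.
Qed.

(** Rows and columns are indexed by arbitrary finite types, so that columns can
    be split off or duplicated by changing J to [option J] or [bool * J]. *)
Definition fillings (I J : finType) (n : nat) (r : I -> nat) :
    {set {ffun J -> {set I}}} :=
  [set f : {ffun J -> {set I}} |
     [forall j, #|f j| == n] && [forall i, \sum_j (i \in f j) == r i]].

Lemma fillingsP (I J : finType) n (r : I -> nat) (f : {ffun J -> {set I}}) :
  reflect ((forall j, #|f j| = n) /\ (forall i, \sum_j (i \in f j) = r i))
          (f \in fillings J n r).
Proof.
rewrite inE; apply: (iffP andP) => -[].
  by move=> /forallP Hc /forallP Hr; split=> x; apply/eqP.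
by move=> Hc Hr; split; apply/forallP => x; apply/eqP.
Qed.

(** One inequality suffices for [card_fillings_bij]: the inverse bijections
    give the other one. *)
Lemma leq_card_fillings_bij (I I' J J' : finType) n (r : I -> nat) (r' : I' -> nat)
    (g : I -> I') (h : J' -> J) :
    bijective g -> bijective h -> (forall i, r' (g i) = r i) ->
  #|fillings J n r| <= #|fillings J' n r'|.
Proof.
move=> gB hB rg; have [h' hK h'K] := hB; have [g' gK g'K] := gB.
pose F (f : {ffun J -> {set I}}) : {ffun J' -> {set I'}} := [ffun j => g @: f (h j)].
have Finj : injective F.
  move=> f1 f2 /ffunP E; apply/ffunP => j.
  by have := E (h' j); rewrite !ffunE h'K => /(imset_inj (bij_inj gB)).
rewrite -(card_imset _ Finj); apply/subset_leq_card/subsetP => _ /imsetP[f fF ->].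
move/fillingsP: fF => [fc fr]; apply/fillingsP; split=> [j|i].
  by rewrite ffunE card_imset ?fc //; apply: bij_inj.
rewrite -(g'K i) rg -fr (reindex h) /=; last exact: onW_bij.
by apply: eq_bigr => j _; rewrite ffunE mem_imset //; apply: bij_inj.
Qed.

Lemma card_fillings_bij (I I' J J' : finType) n (r : I -> nat) (r' : I' -> nat)
    (g : I -> I') (h : J' -> J) :
    bijective g -> bijective h -> (forall i, r' (g i) = r i) ->
  #|fillings J n r| = #|fillings J' n r'|.
Proof.
move=> gB hB rg; apply/eqP; rewrite eqn_leq (leq_card_fillings_bij n gB hB) //=.
have [h' hK h'K] := hB; have [g' gK g'K] := gB.
apply: (@leq_card_fillings_bij _ _ _ _ _ _ _ g' h'); try by [exists h | exists g].
by move=> i; rewrite -rg g'K.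
Qed.

Lemma bij_of_eq_card (T T' : finType) : #|T| = #|T'| ->
  exists f : T -> T', bijective f.
Proof.
move=> e; exists (fun x => enum_val (cast_ord e (enum_rank x))).
exists (fun y => enum_val (cast_ord (esym e) (enum_rank y))) => x;
  by rewrite enum_valK ?cast_ordK ?cast_ordKV enum_rankK.
Qed.

(** The symmetric group is transitive on subsets of a given size. The bijection
    matches the enumerations of T that list S, respectively S', first. *)
Lemma exists_bij_on_sets (T : finType) (S S' : {set T}) : #|S| = #|S'| ->
  exists2 g : T -> T, bijective g & forall x, (g x \in S') = (x \in S).
Proof.
move=> eS; pose s (A : {set T}) := enum A ++ enum (~: A).
have memS A x : x \in s A by rewrite mem_cat !mem_enum inE orbN.
have uniqS A : uniq (s A).
  rewrite cat_uniq !enum_uniq andbT /=; apply/hasPn => x.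
  by rewrite /= !mem_enum inE.
have sizeS A : size (s A) = #|T| by rewrite size_cat -!cardE cardsC.
pose g x := nth x (s S') (index x (s S)).
have ltS A x : index x (s S) < size (s A) by rewrite sizeS -(sizeS S) index_mem.
have gI : injective g.
  move=> x y; rewrite /g (set_nth_default y) // => /eqP.
  by rewrite nth_uniq // => /eqP/index_inj; apply.
exists g => [|x]; first exact: injF_bij.
have inS A y i : i < size (s A) -> (nth y (s A) i \in A) = (i < #|A|).
  rewrite nth_cat -cardE => lti; case: ltnP => h.
    by rewrite -mem_enum mem_nth // -cardE.
  have : nth y (enum (~: A)) (i - #|A|) \in ~: A.
    rewrite -mem_enum mem_nth // -cardE.
    by move: lti; rewrite size_cat -!cardE; lia.
  by rewrite inE => /negPf.
by rewrite /g inS // -eS -(inS S x) // nth_index.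
Qed.

(** * Parity of the number of families *)

(** The involution exchanges the two halves of [bool * J] and fixes [None]. A
    fixed point has row sums [i in f None] + 2 * (an arbitrary row sum over J),
    so its column [None] is forced to be the set of rows with odd sum; the
    hypothesis says that this set has the right size for a column. *)
Lemma odd_card_fillings_double (I J : finType) n (r : I -> nat) :
    #|[set i | odd (r i)]| = n ->
  odd #|fillings (option (bool * J)) n r| =
  odd #|fillings J n (fun i => (r i)./2)|.
Proof.
move=> cO; set O := [set i | odd (r i)] in cO.
pose sw (x : option (bool * J)) := omap (fun p => (~~ p.1, p.2)) x.
have swK : involutive sw by case=> [[b j]|] //=; rewrite negbK.
pose h (f : {ffun option (bool * J) -> {set I}}) := [ffun x => f (sw x)].
have hK : involutive h by move=> f; apply/ffunP => x; rewrite !ffunE swK.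
have hA1 f : f \in fillings _ n r -> h f \in fillings _ n r.
  move=> /fillingsP[fc fr]; apply/fillingsP; split=> [x|i]; first by rewrite ffunE.
  rewrite -fr [RHS](reindex sw) /=; last by apply: onW_bij; exists sw.
  by apply: eq_bigr => x _; rewrite ffunE.
have hA f : (h f \in fillings _ n r) = (f \in fillings _ n r).
  by apply/idP/idP => /hA1 //; rewrite hK.
rewrite (odd_card_involution hK hA).
pose ext (f : {ffun J -> {set I}}) : {ffun option (bool * J) -> {set I}} :=
  [ffun x => if x is Some p then f p.2 else O].
have extI : injective ext.
  move=> f1 f2 /ffunP E; apply/ffunP => j.
  by have := E (Some (true, j)); rewrite !ffunE.
have sumE (f : {ffun option (bool * J) -> {set I}}) i :
    (forall b j, f (Some (b, j)) = f (Some (true, j))) ->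
    \sum_x (i \in f x) =
    (i \in f None) + (\sum_j (i \in f (Some (true, j)))).*2.
  move=> fE; rewrite big_option; congr (_ + _).
  rewrite (eq_bigr (fun p => (i \in f (Some (p.1, p.2))) : nat)) => [|[] //].
  rewrite -(pair_bigA _ (fun b j => (i \in f (Some (b, j))) : nat)) /= big_bool.
  rewrite -addnn; congr (_ + _); by apply: eq_bigr => j _; rewrite fE.
(* The fixed points are exactly the families obtained by duplicating a family
   over J and adding the column O. *)
rewrite -(card_imset _ extI); congr odd; apply: eq_card => f.
rewrite inE; apply/andP/imsetP => [[fA /eqP hf]|[g gA ->]].
  move/fillingsP: fA => [fc fr].
  have fE b j : f (Some (b, j)) = f (Some (true, j)).
    by case: b => //; rewrite -[in LHS]hf ffunE.
  have rE i : r i = (i \in f None) + (\sum_j (i \in f (Some (true, j)))).*2.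
    by rewrite -fr sumE.
  have fO : f None = O.
    by apply/setP => i; rewrite inE rE oddD odd_double addbF oddb.
  exists [ffun j => f (Some (true, j))].
    apply/fillingsP; split=> [j|i]; first by rewrite ffunE.
    rewrite rE half_bit_double.
    by apply: eq_bigr => j _; rewrite ffunE.
  by apply/ffunP => -[[b j]|]; rewrite !ffunE //= fE.
move/fillingsP: gA => [gc gr]; split; last first.
  by apply/eqP/ffunP => -[[b j]|]; rewrite !ffunE.
apply/fillingsP; split=> [[[b j]|]|i]; rewrite ?ffunE //.
rewrite sumE => [|b j]; last by rewrite !ffunE.
rewrite ffunE inE -[RHS]odd_double_half -gr; congr (_ + _.*2).
by apply: eq_bigr => j _; rewrite ffunE.
Qed.

(** The recursive shape of an index set with 2^k - 1 elements that lets
    [odd_card_fillings_double] be applied k times. *)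
Fixpoint columns (k : nat) : finType :=
  if k is k'.+1 then option (bool * columns k') else void.

Lemma card_columns k : #|columns k| = 2 ^ k - 1.
Proof.
elim: k => [|k IHk] /=; first by rewrite card_void.
rewrite card_option card_prod card_bool IHk expnS.
by have := expn_gt0 2 k; lia.
Qed.

(** These are the row sums left for the other 2^(k+1) - 1 columns once S has
    been chosen as the first column. *)
Lemma odd_card_fillings (I : finType) n (S : {set I}) k :
    #|I| = 2 * n -> #|S| = n ->
  odd #|fillings (columns k.+1) n (fun i => 2 ^ k - (i \in S))|.
Proof.
move=> cI cS; elim: k => [|k IHk].
  rewrite /= odd_card_fillings_double; last first.
    transitivity #|~: S|; last by rewrite cardsCs setCK cI cS; lia.
    by apply: eq_card => i; rewrite !inE; case: (i \in S).
  (* All row sums are now 0, and the empty family is the only one. *)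
  suff -> : #|fillings void n (fun i => (2 ^ 0 - (i \in S))./2)| =
            #|[set: {ffun void -> {set I}}]| by rewrite cardsT card_ffun card_void.
  apply: eq_card => f; rewrite [RHS]inE; apply/fillingsP; split=> [[]|i].
  by rewrite big1 => [|[]]; case: (i \in S).
have pk := expn_gt0 2 k.
rewrite odd_card_fillings_double.
  rewrite (@card_fillings_bij _ _ _ _ n _ (fun i => 2 ^ k - (i \in S)) id id) //;
    try by exists id.
  by move=> i /=; rewrite expnS; case: (i \in S); lia.
rewrite -cS; apply: eq_card => i; rewrite inE expnS.
case: (i \in S); lia.
Qed.

(** * Splitting off the first column *)

(** Positivity of r keeps the truncated subtraction from admitting a column S
    through a row that needs no black cell. *)
Lemma card_fillings_option (I J : finType) n (r : I -> nat) :
    (forall i, 0 < r i) ->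
  #|fillings (option J) n r| =
  \sum_(S : {set I} | #|S| == n) #|fillings J n (fun i => r i - (i \in S))|.
Proof.
move=> r_gt0.
rewrite -sum1_card (partition_big (fun f : {ffun _ -> _} => f None)
  (fun S : {set I} => #|S| == n)) /=; last first.
  by move=> f /fillingsP[fc _]; rewrite fc.
apply: eq_bigr => S /eqP cS.
pose ext (f : {ffun J -> {set I}}) : {ffun option J -> {set I}} :=
  [ffun x => if x is Some j then f j else S].
have extI : injective ext.
  move=> f1 f2 /ffunP E; apply/ffunP => j.
  by have := E (Some j); rewrite !ffunE.
rewrite sum1_card -(card_imset _ extI); apply: eq_card => f.
rewrite unfold_in; apply/andP/imsetP => [[/fillingsP[fc fr] /eqP fS]|[g gA ->]].
  exists [ffun j => f (Some j)].
    apply/fillingsP; split=> [j|i]; first by rewrite ffunE.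
    rewrite -fr big_option fS addKn.
    by apply: eq_bigr => j _; rewrite ffunE.
  by apply/ffunP => -[j|]; rewrite !ffunE.
move/fillingsP: gA => [gc gr]; split; last by rewrite ffunE.
apply/fillingsP; split=> [[j|]|i]; rewrite ?ffunE //.
rewrite big_option ffunE.
rewrite (eq_bigr (fun j => (i \in g j) : nat)) => [|j _]; last by rewrite ffunE.
by rewrite gr subnKC //; apply: leq_trans (r_gt0 i); case: (i \in S).
Qed.

(** The conditions on white cells follow from those on black cells, because rows
    and columns have lengths 2m and 2n. *)
Lemma B_fillings m n : B m n = #|fillings 'I_(2 * m) n (fun _ : 'I_(2 * n) => m)|.
Proof.
pose F (C : colouring (2 * m) (2 * n)) : {ffun 'I_(2 * m) -> {set 'I_(2 * n)}} :=
  [ffun j => [set i | C i j]].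
have FI : injective F.
  move=> C1 C2 /ffunP E; apply/matrixP => i j.
  by have /setP/(_ i) := E j; rewrite !ffunE !inE.
rewrite /B -(card_imset _ FI); apply: eq_card => f.
have half a b : b = 2 * a -> forall p : pred 'I_b,
    ((#|[set x | p x]| == a) && (#|[set x | ~~ p x]| == a)) = (#|[set x | p x]| == a).
  move=> -> p; have := cardsC [set x | p x]; rewrite card_ord.
  rewrite (_ : ~: _ = [set x | ~~ p x]); last by apply/setP => x; rewrite !inE.
  by move=> e; apply/idP/idP; lia.
have balE C : balanced C = (F C \in fillings _ n (fun _ => m)).
  rewrite inE /balanced andbC; congr (_ && _); apply: eq_forallb => x.
    by rewrite half // ffunE.
  rewrite half // -sum1dep_card big_mkcond /=; congr (_ == _).
  by apply: eq_bigr => j _; rewrite ffunE inE; case: (C x j).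
apply/imsetP/idP => [[C]|fA]; first by rewrite inE balE => ? ->.
have fE : f = F (\matrix_(i, j) (i \in f j))%R.
  by apply/ffunP => j; apply/setP => i; rewrite ffunE inE mxE.
by exists (\matrix_(i, j) (i \in f j))%R => //; rewrite inE balE -fE.
Qed.

(** * The exponent of 2 in the central binomial coefficient *)

(** Legendre's formula for p = 2. With a_i = n %/ 2^i, the binary digit of index
    i is a_i - 2 * a_(i+1), and the exponent of 2 in n! is the sum of the
    a_(i+1); digits plus exponent therefore telescope to a_0 - a_n = n. *)
Lemma s2_add_logn_fact n : s2 n + logn 2 n`! = n.
Proof.
pose a i := n %/ 2 ^ i.
have an0 : a n = 0 by rewrite /a divn_small // ltn_expl.
have -> : s2 n = \sum_(i < n) binary_digit n i.
  rewrite /s2 -sum1dep_card big_mkcond /=; apply: eq_bigr => i _.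
  rewrite /binary_digit modn2; by case: odd.
rewrite logn_fact // big_add1 /= big_mkord -big_split /=.
have telescope k : \sum_(i < k) (binary_digit n i + a i.+1) + a k = n.
  elim: k => [|k IHk]; first by rewrite big_ord0 /a divn1.
  rewrite big_ord_recr /= -[RHS]IHk -addnA; congr (_ + _).
  rewrite /binary_digit /a expnSr divnMA.
  by have := divn_eq (n %/ 2 ^ k) 2; lia.
by have := telescope n; rewrite an0 addn0.
Qed.

(** The product (2n)! consists of odd factors and of 2 * 1, ..., 2 * n. *)
Lemma logn_fact_double n : logn 2 (2 * n)`! = n + logn 2 n`!.
Proof.
elim: n => [|n IHn] //; rewrite mulnS !factS !lognM ?muln_gt0 ?fact_gt0 //.
have -> : (2 * n).+2 = 2 * n.+1 by rewrite mulnS.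
rewrite lognM // logn_prime // IHn.
rewrite (_ : logn 2 (2 * n).+1 = 0); first by lia.
by rewrite logn_coprime // coprime2n /= oddM.
Qed.

Lemma logn_central_binomial n : logn 2 'C(2 * n, n) = s2 n.
Proof.
have le_n : n <= 2 * n by rewrite leq_pmull.
have /(congr1 (logn 2)) := bin_fact le_n.
rewrite !lognM ?muln_gt0 ?fact_gt0 ?bin_gt0 // logn_fact_double.
by rewrite (_ : 2 * n - n = n); have := s2_add_logn_fact n; lia.
Qed.

(** * The exponent of 2 in the number of balanced colourings *)

Theorem theorem1 (m n : nat) (m_gt0 : 0 < m) (n_gt0 : 0 < n)
  (m_pow2 : exists k : nat, m = 2 ^ k) :
  logn 2 (B m n) = s2 n.
Proof.
case: m_pow2 => k mE.
have [h hB] : exists h : option (columns k.+1) -> 'I_(2 * m), bijective h.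
  apply: bij_of_eq_card; rewrite card_option card_columns card_ord mE expnS.
  by have := expn_gt0 2 k; lia.
rewrite B_fillings (@card_fillings_bij _ _ _ _ _ _ (fun=> m) id h) //; last by exists id.
rewrite card_fillings_option //.
(* Any n-set of rows serves as the reference first column. *)
have [S0] : exists S : {set 'I_(2 * n)}, S \in [set S : {set 'I_(2 * n)} | #|S| == n].
  by apply/set0Pn; rewrite -card_gt0 card_draws card_ord bin_gt0; lia.
rewrite inE => /eqP cS0.
pose A := #|fillings (columns k.+1) n (fun i => m - (i \in S0))|.
rewrite (eq_bigr (fun=> A)) => [|S /eqP cS]; last first.
  have [g gB gS] := exists_bij_on_sets (etrans cS (esym cS0)).
  by apply: (card_fillings_bij n gB (h := id)) => [|i]; [exists id | rewrite gS].
have oddA : odd A by rewrite /A mE odd_card_fillings ?card_ord.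
rewrite sum_nat_const.
have -> : #|[pred S : {set 'I_(2 * n)} | #|S| == n]| = 'C(2 * n, n).
  by rewrite -[in RHS](card_ord (2 * n)) -card_draws cardsE.
rewrite lognM ?bin_gt0 ?leq_pmull ?(odd_gt0 oddA) //.
by rewrite (@logn_coprime 2 A) ?coprime2n // addn0 logn_central_binomial.
Qed.
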